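(* If $A$ is a dwindlable Weil algebra, then its subalgebra $SA$ of fixed points is trivial, i.e. $SA=\mathbb{R}$. Moreover, the converse fails: there exist Weil algebras $A$ that are not dwindlable and whose subalgebra $SA$ of fixed points is trivial.
   Context: A Weil algebra is a local commutative $\mathbb{R}$-algebra $A$ with identity whose nilradical (ideal of nilpotent elements) $\mathfrak{n}_A$ has finite dimension as a real vector space and satisfies $A/\mathfrak{n}_A=\mathbb{R}$. $\mathrm{Aut}\,A$ denotes the group of $\mathbb{R}$-algebra automorphisms of $A$, and $SA=\{a\in A;\ \phi(a)=a\text{ for all }\phi\in\mathrm{Aut}\,A\}$ is the subalgebra of fixed points (also called fixed elements) of $A$. It always contains the constants $\mathbb{R}=\mathbb{R}\cdot 1$; it is called trivial if $SA=\mathbb{R}$. The canonical algebra homomorphism $\kappa_A\colon A\to A/\mathfrak{n}_A=\mathbb{R}$ is viewed as an endomorphism $\kappa_A\colon A\to A$ via the inclusion $\mathbb{R}=\mathbb{R}\cdot 1\subseteq A$. A Weil algebra $A$ is called dwindlable if there is an infinite sequence $\{\phi_n\}_{n=1}^\infty$ of automorphisms $\phi_n\in\mathrm{Aut}\,A$ such that $\phi_n\to\kappa_A$ as $n\to\infty$, where convergence is with respect to the usual Euclidean topology on the finite-dimensional real vector space of linear endomorphisms of $A$. *)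

(* Defs.v *)
From HB Require Import structures.
From mathcomp Require Import all_boot all_order all_algebra.
From mathcomp Require Import ring_quotient.
From mathcomp Require Import all_classical all_reals all_analysis.

Set Implicit Arguments.
Unset Strict Implicit.
Unset Printing Implicit Defensive.

Import Order.TTheory GRing.Theory Num.Theory.
Import numFieldNormedType.Exports.

Local Open Scope classical_set_scope.
Local Open Scope ring_scope.

Section Rings.
Variable A : comNzRingType.

Definition nilradical : {pred A} := fun a => `[< exists n, a ^+ n = 0 >].

Lemma nilradicalP (a : A) :
  reflect (exists n, a ^+ n = 0) (a \in nilradical).
Proof. exact: asboolP. Qed.

Lemma nilradical_idealr : idealr_closed nilradical.
Proof.
split; first by apply/nilradicalP; exists 1%N; rewrite expr1.
  by apply/nilradicalP => -[n]; rewrite expr1n; apply/eqP/oner_neq0.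
move=> a u v /nilradicalP[m um] /nilradicalP[n vn].
apply/nilradicalP; exists (m + n)%N.
rewrite exprDn big1// => -[i /= _] _; have [lt_ni|le_in] := ltnP n i.
  by rewrite -[i in v ^+ i](subnKC (ltnW lt_ni)) exprD vn mul0r mulr0 mul0rn.
rewrite exprMn -(addnBA m le_in) (exprD u) um.
by rewrite mul0r mulr0 mul0r mul0rn.
Qed.

HB.instance Definition _ := isIdealr.Build A nilradical nilradical_idealr.

(* [idealr_closed] only describes proper ideals. *)
Definition maximal_ideal (I : {pred A}) : Prop :=
  idealr_closed I /\
  forall J : {pred A}, idealr_closed J -> {subset I <= J} -> J =i I.

Definition local_ring : Prop :=
  exists2 I : {pred A}, maximal_ideal I &
    forall J : {pred A}, maximal_ideal J -> J =i I.

End Rings.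

Arguments nilradical A : clear implicits.
Arguments local_ring A : clear implicits.

Section Lmodules.
Variables (R : realType) (V : lmodType R).

Definition finite_dim_subspace (U : set V) : Prop :=
  exists n (e : 'I_n -> V),
    U = range (fun c : 'rV[R]_n => \sum_i c 0 i *: e i).

Definition is_basis n (e : 'I_n -> V) : Prop :=
  forall v, exists! c : 'rV[R]_n, v = \sum_i c 0 i *: e i.

(* The coordinates of [v], provided [e] is a basis. *)
Definition basis_coord n (e : 'I_n -> V) (v : V) : 'rV[R]_n :=
  xget 0 [set c : 'rV[R]_n | v = \sum_i c 0 i *: e i].

Definition endo_mx n (e : 'I_n -> V) (f : V -> V) : 'M[R]_n :=
  \matrix_(i, j) basis_coord e (f (e i)) 0 j.

(* The Euclidean topology on the endomorphisms of a finite-dimensional space is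
   transported from 'M[R]_n along a basis, and does not depend on the basis. *)
Definition endo_cvg (f : nat -> V -> V) (g : V -> V) : Prop :=
  exists n (e : 'I_n -> V),
    is_basis e /\ endo_mx e (f k) @[k --> \oo] --> endo_mx e g.

End Lmodules.

Section WeilAlgebras.
Variables (R : realType) (A : comAlgType R).

Definition residue (a : A) : {ideal_quot (nilradical A)} := (\pi a)%qT.

(* The quotient A/n_A equals R when the structure map of this R-algebra is
   bijective. *)
Definition weil_algebra : Prop :=
  [/\ local_ring A,
      finite_dim_subspace [set a : A | a \in nilradical A] &
      bijective (fun c : R => residue c%:A)].

(* The image in A of the real number identified with the class of [a], provided
   [A] is a Weil algebra. *)
Definition kappa (a : A) : A :=
  (xget 0 [set c : R | residue c%:A = residue a])%:A.

Definition automorphism (phi : {lrmorphism A -> A}) : Prop := bijective phi.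

Definition fixed_points : set A :=
  [set a | forall phi : {lrmorphism A -> A}, automorphism phi -> phi a = a].

Definition constants : set A := range (fun c : R => c%:A).

Definition dwindlable : Prop :=
  exists phi : nat -> {lrmorphism A -> A},
    (forall n, automorphism (phi n)) /\ endo_cvg phi kappa.

End WeilAlgebras.

Arguments weil_algebra {R} A.
Arguments fixed_points {R} A.
Arguments constants {R} A.
Arguments dwindlable {R} A.

(* Main.v *)
Require Import Defs.
From HB Require Import structures.
From mathcomp Require Import all_boot all_order all_algebra ring_quotient.
From mathcomp Require Import all_classical all_reals all_analysis.
From mathcomp Require Import ring lra.

(** If automorphisms phi_n converge to kappa, then a fixed point a is the limit
    of the constant sequence phi_n a = a, so a = kappa a is a real constant.
    This is [dwindlable_fixed_points]; it rests on the fact that convergence of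
    matrices implies convergence of every value l (phi_n v), for l a linear
    functional ([endo_cvg_functional]).

    For the converse, the aim is an algebra with enough automorphisms to move
    every nonconstant element, but whose relations forbid the generators to
    shrink. Take generators x, y, m with xy = 0, m^2 = 0 and every product of
    m with three elements of the nilradical equal to zero, and add the two
    relations
      x^3 = y^5   and   x^2 m = y^2 m.
    If an automorphism multiplies x by a and y by d up to other terms, the first
    relation gives a^3 = d^5 and the second a^2 = d^2, whence a^2 = 1
    ([automorphism_cx_sqr]); since kappa x = 0, the algebra is not dwindlable.
    Over the subalgebra generated by x and y, the generator m spans a module
    that can be rescaled freely and into which the derivations x d/dx and
    y d/dy take values; together with the sign change (x, y) -> (- x, - y),
    possible because 3 and 5 are odd, and with the substitutions
    y -> y / (1 - k y), the resulting automorphisms have only constant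
    common fixed points ([rigid_fixed_points]). *)

Set Implicit Arguments.
Unset Strict Implicit.
Unset Printing Implicit Defensive.

Import GRing.Theory Num.Theory.
Import numFieldNormedType.Exports.

Local Open Scope classical_set_scope.
Local Open Scope ring_scope.

(** * Coordinates and convergence of endomorphisms *)

Section EndomorphismConvergence.
Variables (R : realType) (V : lmodType R).

Lemma basis_coordE n (e : 'I_n -> V) : is_basis e ->
  forall v, v = \sum_i basis_coord e v 0 i *: e i.
Proof.
move=> be v; have [c [vE _]] := be v.
exact: (@xgetI _ 0 [set d : 'rV[R]_n | v = \sum_i d 0 i *: e i] c).
Qed.

Lemma basis_coord_inj n (e : 'I_n -> V) : is_basis e ->
  injective (basis_coord e).
Proof.
by move=> be u v uv; rewrite [LHS](basis_coordE be) uv -(basis_coordE be).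
Qed.

Lemma basis_coord_linear n (e : 'I_n -> V) : is_basis e ->
  linear (basis_coord e).
Proof.
move=> be k u v; have [c [_ cU]] := be (k *: u + v).
rewrite -(cU _ (basis_coordE be _)); apply: cU.
rewrite {1}(basis_coordE be u) {1}(basis_coordE be v) scaler_sumr -big_split.
by apply: eq_bigr => i _; rewrite !mxE scalerDl scalerA.
Qed.

(** Expanding v and its image in the basis that witnesses the convergence
    turns l (f v) into a fixed linear combination of the matrix entries of f,
    and each entry is a continuous function of the matrix. *)
Lemma endo_cvg_functional (f : nat -> V -> V) (g : V -> V) (l : V -> R^o) v :
  (forall k, linear (f k)) -> linear g -> linear l -> endo_cvg f g ->
  l (f k v) @[k --> \oo] --> l (g v).
Proof.
move=> flin glin llin [n [e [be fg]]].
have lE (h : V -> V) : linear h -> l (h v) =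
    \sum_i basis_coord e v 0 i * \sum_j endo_mx e h i j * l (e j).
  move=> hlin.
  pose H := HB.pack_for {linear V -> V} h (GRing.isLinear.Build _ _ _ _ h hlin).
  pose L := HB.pack_for {linear V -> R^o} l
    (GRing.isLinear.Build _ _ _ _ l llin).
  rewrite {1}(basis_coordE be v) -[h _]/(H _) -[l _]/(L _) !linear_sum.
  apply: eq_bigr => i _; rewrite !linearZ /= -/(h _); congr (_ * _).
  rewrite {1}(basis_coordE be (h (e i))) -[l _]/(L _) linear_sum.
  by apply: eq_bigr => j _; rewrite linearZ /= mxE.
rewrite (lE g glin).
under eq_fun do rewrite (lE _ (flin _)).
apply: cvg_big => [|i _]; first exact: add_continuous.
apply: cvgMr; apply: cvg_big => [|j _]; first exact: add_continuous.
apply: cvgMl; exact: (cvg_comp _ _ fg (@coord_continuous _ _ _ i j _)).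
Qed.

End EndomorphismConvergence.

(** * Weil algebras *)

Section WeilAlgebras.
Variables (R : realType) (A : comAlgType R).
Implicit Types (a b : A) (c d : R).

Lemma residueP a b : residue a = residue b <-> a - b \in nilradical A.
Proof.
by rewrite Quotient.idealrBE; split => /eqP.
Qed.

Lemma nilradical_scalar c : (c%:A : A) \in nilradical A -> c = 0.
Proof.
move=> /nilradicalP[n]; rewrite exprZn expr1n => /eqP.
by rewrite scaler_eq0 oner_eq0 orbF expf_eq0 => /andP[_ /eqP].
Qed.

(** The real part of an element is unique, because a nilpotent real number is
    zero. *)
Lemma scalar_inj c d a :
  a - c%:A \in nilradical A -> a - d%:A \in nilradical A -> c = d.
Proof.
move=> ac ad; apply: subr0_eq; apply: nilradical_scalar.
have -> : (c - d)%:A = (a - d%:A) - (a - c%:A).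
  by rewrite scalerBl [RHS]addrC opprB addrA subrK.
exact: rpredB.
Qed.

(** The inverse of 1 - a is the geometric series, which stops at the power
    where a vanishes. *)
Lemma nilpotent_onesub_unit a : a \in nilradical A -> exists b, b * (1 - a) = 1.
Proof.
move=> /nilradicalP[n an]; exists (\sum_(i < n) a ^+ i).
by rewrite mulrC -opprB mulNr -subrX1 an sub0r opprK.
Qed.

Lemma kappaE a c : a - c%:A \in nilradical A -> kappa a = c%:A.
Proof.
move=> ac; rewrite /kappa; congr (_ *: _).
apply: xget_unique => [|d /residueP da].
  by apply/residueP; rewrite -opprB rpredN.
by apply: (scalar_inj _ ac); rewrite -opprB rpredN.
Qed.

Lemma constants_fixed : constants A `<=` fixed_points A.
Proof.
by move=> _ [c _ <-] phi _; rewrite linearZ rmorph1.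
Qed.

(** Fixed points are tested on plain functions, which spares a bundled
    morphism for each automorphism in use. *)
Lemma fixed_points_bij (f g : A -> A) a :
  linear f -> monoid_morphism f -> cancel f g -> cancel g f ->
  fixed_points A a -> f a = a.
Proof.
move=> flin fmul fK gK fix_a.
pose phi := HB.pack_for {lrmorphism A -> A} f
  (GRing.isLinear.Build _ _ _ _ f flin)
  (GRing.isMonoidMorphism.Build _ _ f fmul).
by apply: (fix_a phi); exists g.
Qed.

Hypothesis residue_real : forall a, exists c, a - c%:A \in nilradical A.

(** An element a outside the nilradical is c + n with c != 0 and n nilpotent,
    so a / c = 1 - (1 - a / c) is invertible and no proper ideal contains a. *)
Lemma ideal_sub_nilradical (J : {pred A}) :
  idealr_closed J -> {subset J <= nilradical A}.
Proof.
move=> [J0 J1 Jlin] a Ja; have [c ac] := residue_real a.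
move: ac; have [->|c0] := eqVneq c 0; first by rewrite scale0r subr0.
move=> ac.
have [b b1] : exists b, b * (1 - (1 - c^-1 *: a)) = 1.
  apply: nilpotent_onesub_unit; rewrite (_ : _ - _ = - c^-1%:A * (a - c%:A)).
    exact: idealMr.
  by rewrite mulNr -scalerAl mul1r scalerBr scalerA mulVf// scale1r opprB.
case/negP: J1; rewrite -b1 opprB addrC subrK.
by rewrite -[_ *: a]mulr_algl mulrA -[_ * a]addr0; apply: Jlin.
Qed.

(** By the preceding lemma the nilradical contains every proper ideal, so it is
    the only maximal one. *)
Lemma weil_local_ring : local_ring A.
Proof.
have nmax : maximal_ideal (nilradical A).
  split; first exact: nilradical_idealr.
  by move=> J Jid nJ a; apply/idP/idP; [exact: ideal_sub_nilradical|exact: nJ].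
exists (nilradical A) => // J [Jid Jmax] a; apply/esym.
exact: (Jmax _ nmax.1 (ideal_sub_nilradical Jid)).
Qed.

Lemma weil_algebraI :
  finite_dim_subspace [set a | a \in nilradical A] -> weil_algebra A.
Proof.
move=> fin; split=> //; first exact: weil_local_ring.
have /choice[r rP] : forall q : {ideal_quot (nilradical A)},
    exists c : R, residue (c%:A : A) = q.
  elim/quotW => a; have [c ac] := residue_real a; exists c.
  by apply/residueP; rewrite -opprB rpredN.
exists r => // c; apply: (@scalar_inj _ _ c%:A); last by rewrite subrr rpred0.
by apply/residueP; rewrite rP.
Qed.

End WeilAlgebras.

Section Kappa.
Variables (R : realType) (A : comAlgType R).
Implicit Types (a b : A) (c d : R).

Hypothesis weilA : weil_algebra A.

Lemma weil_split a : exists c, a - c%:A \in nilradical A.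
Proof.
case: weilA => _ _ [g _ gK]; exists (g (residue a)).
by apply/residueP; rewrite gK.
Qed.

Lemma kappa_linear : linear (@kappa R A).
Proof.
move=> k a b; have [c ac] := weil_split a; have [d bd] := weil_split b.
rewrite (kappaE ac) (kappaE bd) scalerA -scalerDl; apply: kappaE.
rewrite scalerDl opprD addrACA -scalerA -scalerBr rpredD//.
by rewrite -[_ *: _]mulr_algl; exact: idealMr.
Qed.

(** The values phi_n a at a fixed point a form a constant sequence, which
    converges to kappa a by dwindlability. As limits of real sequences are
    unique, a and kappa a have the same coordinates. *)
Lemma dwindlable_fixed_points : dwindlable A -> fixed_points A = constants A.
Proof.
move=> [phi [phiA phi_kappa]]; apply/seteqP; split; last exact: constants_fixed.
move=> a fix_a; suff -> : a = kappa a by rewrite /kappa; eexists.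
have [n [e [be _]]] := phi_kappa.
apply: (basis_coord_inj be); apply/rowP => i.
pose l v := basis_coord e v 0 i : R^o.
have llin : linear l by move=> k u v; rewrite /l basis_coord_linear// !mxE.
have la : l (phi k a) @[k --> \oo] --> l (kappa a).
  exact: endo_cvg_functional (fun k => linearP (phi k)) kappa_linear llin
    phi_kappa.
have phia : (fun k => l (phi k a)) = cst (l a).
  by apply/funext => k; rewrite /cst; congr l; exact: fix_a.
rewrite phia in la; exact: (cvg_unique (@norm_hausdorff _ _) (cvg_cst _) la).
Qed.

End Kappa.

(** * A Weil algebra that is not dwindlable *)

(** The algebra R[x, y, m] / (xy, x^3 - y^5, m^2, (x^2 - y^2) m, n^3 m), n being
    the ideal generated by x, y and m. An element is given by its coordinates
    in the monomial basis 1, x, x^2, y, y^2, y^3, y^4, s, m, xm, ym, t, where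
    s = x^3 = y^5 and t = x^2 m = y^2 m. *)
Record rigid (R : Type) := Rigid {
  c1 : R; cx : R; cx2 : R; cy : R; cy2 : R; cy3 : R; cy4 : R; cs : R;
  cm : R; cxm : R; cym : R; ct : R }.

HB.instance Definition _ R := gen_eqMixin (rigid R).
HB.instance Definition _ R := gen_choiceMixin (rigid R).

Lemma rigid_ext (R : Type) (u v : rigid R) :
  c1 u = c1 v -> cx u = cx v -> cx2 u = cx2 v -> cy u = cy v ->
  cy2 u = cy2 v -> cy3 u = cy3 v -> cy4 u = cy4 v -> cs u = cs v ->
  cm u = cm v -> cxm u = cxm v -> cym u = cym v -> ct u = ct v -> u = v.
Proof. by case: u v => ? ? ? ? ? ? ? ? ? ? ? ? [/= *]; congr Rigid. Qed.

Local Ltac by_coef := apply: rigid_ext => /=; ring.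

Section RigidAlgebra.
Variable R : realType.
Implicit Types (u v w : rigid R) (k : R).

Definition rigid_zero : rigid R := Rigid 0 0 0 0 0 0 0 0 0 0 0 0.

Definition rigid_one : rigid R := Rigid 1 0 0 0 0 0 0 0 0 0 0 0.

Definition rigid_opp u : rigid R :=
  Rigid (- c1 u) (- cx u) (- cx2 u) (- cy u) (- cy2 u) (- cy3 u) (- cy4 u)
    (- cs u) (- cm u) (- cxm u) (- cym u) (- ct u).

Definition rigid_add u v : rigid R :=
  Rigid (c1 u + c1 v) (cx u + cx v) (cx2 u + cx2 v) (cy u + cy v)
    (cy2 u + cy2 v) (cy3 u + cy3 v) (cy4 u + cy4 v) (cs u + cs v)
    (cm u + cm v) (cxm u + cxm v) (cym u + cym v) (ct u + ct v).

Definition rigid_scale k u : rigid R :=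
  Rigid (k * c1 u) (k * cx u) (k * cx2 u) (k * cy u) (k * cy2 u) (k * cy3 u)
    (k * cy4 u) (k * cs u) (k * cm u) (k * cxm u) (k * cym u) (k * ct u).

Definition rigid_mul u v : rigid R := Rigid
  (c1 u * c1 v)
  (c1 u * cx v + cx u * c1 v)
  (c1 u * cx2 v + cx u * cx v + cx2 u * c1 v)
  (c1 u * cy v + cy u * c1 v)
  (c1 u * cy2 v + cy u * cy v + cy2 u * c1 v)
  (c1 u * cy3 v + cy u * cy2 v + cy2 u * cy v + cy3 u * c1 v)
  (c1 u * cy4 v + cy u * cy3 v + cy2 u * cy2 v + cy3 u * cy v + cy4 u * c1 v)
  (c1 u * cs v + cs u * c1 v + cx u * cx2 v + cx2 u * cx v
     + cy u * cy4 v + cy2 u * cy3 v + cy3 u * cy2 v + cy4 u * cy v)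
  (c1 u * cm v + cm u * c1 v)
  (c1 u * cxm v + cx u * cm v + cm u * cx v + cxm u * c1 v)
  (c1 u * cym v + cy u * cm v + cm u * cy v + cym u * c1 v)
  (c1 u * ct v + ct u * c1 v + cx u * cxm v + cxm u * cx v
     + cy u * cym v + cym u * cy v
     + (cx2 u + cy2 u) * cm v + cm u * (cx2 v + cy2 v)).

Lemma rigid_addA : associative rigid_add. Proof. by move=> u v w; by_coef. Qed.
Lemma rigid_addC : commutative rigid_add. Proof. by move=> u v; by_coef. Qed.
Lemma rigid_add0 : left_id rigid_zero rigid_add.
Proof. by move=> u; by_coef. Qed.
Lemma rigid_addN : left_inverse rigid_zero rigid_opp rigid_add.
Proof. by move=> u; by_coef. Qed.

HB.instance Definition _ :=
  GRing.isZmodule.Build (rigid R) rigid_addA rigid_addC rigid_add0 rigid_addN.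

Lemma rigid_mulA : associative rigid_mul. Proof. by move=> u v w; by_coef. Qed.
Lemma rigid_mulC : commutative rigid_mul. Proof. by move=> u v; by_coef. Qed.
Lemma rigid_mul1 : left_id rigid_one rigid_mul.
Proof. by move=> u; by_coef. Qed.
Lemma rigid_mulDl : left_distributive rigid_mul +%R.
Proof. by move=> u v w; by_coef. Qed.
Lemma rigid_one_neq0 : rigid_one != 0.
Proof. by apply/eqP => /(congr1 (@c1 R))/eqP; rewrite oner_eq0. Qed.

HB.instance Definition _ := GRing.Zmodule_isComNzRing.Build (rigid R)
  rigid_mulA rigid_mulC rigid_mul1 rigid_mulDl rigid_one_neq0.

Lemma rigid_scaleA k l u :
  rigid_scale k (rigid_scale l u) = rigid_scale (k * l) u.
Proof. by_coef. Qed.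
Lemma rigid_scale1 : left_id 1 rigid_scale.
Proof. by move=> u; by_coef. Qed.
Lemma rigid_scaleDr : right_distributive rigid_scale +%R.
Proof. by move=> k u v; by_coef. Qed.
Lemma rigid_scaleDl u : {morph rigid_scale^~ u : k l / k + l}.
Proof. by move=> k l; by_coef. Qed.

HB.instance Definition _ := GRing.Zmodule_isLmodule.Build R (rigid R)
  rigid_scaleA rigid_scale1 rigid_scaleDr rigid_scaleDl.

Lemma rigid_scaleAl k u v : k *: (u * v) = (k *: u) * v.
Proof. by_coef. Qed.

HB.instance Definition _ := GRing.Lmodule_isLalgebra.Build R (rigid R)
  rigid_scaleAl.
HB.instance Definition _ := GRing.Lalgebra_isComAlgebra.Build R (rigid R).

Lemma c1_expr u n : c1 (u ^+ n) = c1 u ^+ n.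
Proof. by elim: n => // n IHn; rewrite !exprS -IHn. Qed.

(** The first coordinate is a ring morphism onto a field, hence kills the
    nilpotent elements; conversely the longest nonzero product of the
    generators is y^5, so n^6 = 0. *)
Lemma nilradical_rigid u : (u \in nilradical (rigid R)) = (c1 u == 0).
Proof.
apply/nilradicalP/eqP => [[n] /(congr1 (@c1 R))/eqP|u0].
  by rewrite c1_expr expf_eq0 => /andP[_ /eqP].
exists 6%N; rewrite !exprS expr0; apply: rigid_ext; rewrite /= u0; ring.
Qed.

Lemma rigid_finite_dim :
  finite_dim_subspace [set u | u \in nilradical (rigid R)].
Proof.
pose e (i : 'I_11) : rigid R :=
  nth 0 [:: Rigid 0 1 0 0 0 0 0 0 0 0 0 0; Rigid 0 0 1 0 0 0 0 0 0 0 0 0;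
            Rigid 0 0 0 1 0 0 0 0 0 0 0 0; Rigid 0 0 0 0 1 0 0 0 0 0 0 0;
            Rigid 0 0 0 0 0 1 0 0 0 0 0 0; Rigid 0 0 0 0 0 0 1 0 0 0 0 0;
            Rigid 0 0 0 0 0 0 0 1 0 0 0 0; Rigid 0 0 0 0 0 0 0 0 1 0 0 0;
            Rigid 0 0 0 0 0 0 0 0 0 1 0 0; Rigid 0 0 0 0 0 0 0 0 0 0 1 0;
            Rigid 0 0 0 0 0 0 0 0 0 0 0 1] i.
exists 11%N, e; apply/seteqP; split => [u /=|_ [c _ <-] /=].
  rewrite nilradical_rigid => /eqP u0.
  exists (\row_(i < 11) nth 0 [:: cx u; cx2 u; cy u; cy2 u; cy3 u; cy4 u; cs u;
                                 cm u; cxm u; cym u; ct u] i) => //.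
  rewrite !big_ord_recl big_ord0 !mxE.
  by apply: rigid_ext => /=; rewrite ?u0; ring.
rewrite rpred_sum// => i _; rewrite nilradical_rigid /= -/(e i).
suff -> : c1 (e i) = 0 by rewrite mulr0.
by rewrite /e; case: i; do 11?[case=> //].
Qed.

Lemma weil_rigid : weil_algebra (rigid R).
Proof.
apply: weil_algebraI rigid_finite_dim => u; exists (c1 u).
by rewrite nilradical_rigid /= mulr1 subrr.
Qed.

End RigidAlgebra.

(** * Automorphisms and fixed points *)

Section RigidAutomorphisms.
Variable R : realType.
Implicit Types (u v w : rigid R) (k : R).

(** The automorphism fixing x and y and sending m to k m. *)
Definition dilate k u : rigid R :=
  Rigid (c1 u) (cx u) (cx2 u) (cy u) (cy2 u) (cy3 u) (cy4 u) (cs u)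
    (k * cm u) (k * cxm u) (k * cym u) (k * ct u).

(** The automorphism changing the sign of x and y and fixing m: both sides of
    x^3 = y^5 have odd degree in x and y, and (x^2 - y^2) m has even degree. *)
Definition negate u : rigid R :=
  Rigid (c1 u) (- cx u) (cx2 u) (- cy u) (cy2 u) (- cy3 u) (cy4 u) (- cs u)
    (cm u) (- cxm u) (- cym u) (ct u).

(** The automorphism x -> x + p xm, y -> y + q ym, m -> m. The linear
    perturbation of x^2 is 2 p t, that of y^2 is 2 q t, and s is fixed since
    n^3 m = 0. *)
Definition shear p q u : rigid R :=
  Rigid (c1 u) (cx u) (cx2 u) (cy u) (cy2 u) (cy3 u) (cy4 u) (cs u)
    (cm u) (cxm u + p * cx u) (cym u + q * cy u)
    (ct u + 2 * p * cx2 u + 2 * q * cy2 u).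

(** The automorphism x -> x, m -> m, y -> y / (1 - k y) expanded in powers of y.
    These substitutions compose by adding their parameters, so changing k into
    - k inverts them. They fix y^5, hence respect x^3 = y^5. *)
Definition bend k u : rigid R :=
  Rigid (c1 u) (cx u) (cx2 u) (cy u) (cy2 u + k * cy u)
    (cy3 u + 2 * k * cy2 u + k ^+ 2 * cy u)
    (cy4 u + 3 * k * cy3 u + 3 * k ^+ 2 * cy2 u + k ^+ 3 * cy u)
    (cs u + 4 * k * cy4 u + 6 * k ^+ 2 * cy3 u + 4 * k ^+ 3 * cy2 u
      + k ^+ 4 * cy u)
    (cm u) (cxm u) (cym u) (ct u + k * cym u).

Lemma dilate_fixed k u : k != 0 -> fixed_points (rigid R) u -> dilate k u = u.
Proof.
move=> k0; apply: (@fixed_points_bij _ _ _ (dilate k^-1)).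
- by move=> l v w; by_coef.
- by split=> [|v w]; by_coef.
- by move=> v; apply: rigid_ext => //=; rewrite mulKf.
- by move=> v; apply: rigid_ext => //=; rewrite mulVKf.
Qed.

Lemma negate_fixed u : fixed_points (rigid R) u -> negate u = u.
Proof.
apply: (@fixed_points_bij _ _ _ negate).
- by move=> l v w; by_coef.
- by split=> [|v w]; by_coef.
- by move=> v; by_coef.
- by move=> v; by_coef.
Qed.

Lemma shear_fixed p q u : fixed_points (rigid R) u -> shear p q u = u.
Proof.
apply: (@fixed_points_bij _ _ _ (shear (- p) (- q))).
- by move=> l v w; by_coef.
- by split=> [|v w]; by_coef.
- by move=> v; by_coef.
- by move=> v; by_coef.
Qed.

Lemma bend_fixed k u : fixed_points (rigid R) u -> bend k u = u.
Proof.
apply: (@fixed_points_bij _ _ _ (bend (- k))).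
- by move=> l v w; by_coef.
- by split=> [|v w]; by_coef.
- by move=> v; by_coef.
- by move=> v; by_coef.
Qed.

(** Each basis element other than 1 is moved: dilations move m, xm, ym and t;
    the sign change moves x, y, y^3 and s; what is left, x^2, y^2 and y^4, is
    detected on t by shears and on s by a bend. *)
Lemma rigid_fixed_points : fixed_points (rigid R) = constants (rigid R).
Proof.
apply/seteqP; split; last exact: constants_fixed.
move=> u fu; exists (c1 u) => //.
have d2 := dilate_fixed (k := 2) (lt0r_neq0 (ltr0Sn R 1)) fu.
have m0 : 2 * cm u = cm u := congr1 (@cm R) d2.
have xm0 : 2 * cxm u = cxm u := congr1 (@cxm R) d2.
have ym0 : 2 * cym u = cym u := congr1 (@cym R) d2.
have t0 : 2 * ct u = ct u := congr1 (@ct R) d2.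
have x0 : - cx u = cx u := congr1 (@cx R) (negate_fixed fu).
have y0 : - cy u = cy u := congr1 (@cy R) (negate_fixed fu).
have y30 : - cy3 u = cy3 u := congr1 (@cy3 R) (negate_fixed fu).
have s0 : - cs u = cs u := congr1 (@cs R) (negate_fixed fu).
have /= x20 := congr1 (@ct R) (shear_fixed 1 0 fu).
have /= y20 := congr1 (@ct R) (shear_fixed 0 1 fu).
have /= y40 := congr1 (@cs R) (bend_fixed 1 fu).
by apply: rigid_ext => /=; lra.
Qed.

(** * Rigidity of the linear parts *)

Definition rx : rigid R := Rigid 0 1 0 0 0 0 0 0 0 0 0 0.
Definition ry : rigid R := Rigid 0 0 0 1 0 0 0 0 0 0 0 0.
Definition rm : rigid R := Rigid 0 0 0 0 0 0 0 0 1 0 0 0.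

(** Let a, d and r be the coordinates of phi x on x, of phi y on y and of phi m
    on m. Applying phi to the two nonzero socle elements s = x^3 = y^5 and
    t = x^2 m = y^2 m gives a^3 = d^5 and a^2 r = d^2 r with a and r nonzero. Hence
    a^6 = d^10 = a^10, so a^4 = 1 and a^2 = 1. The relations xy = 0 and m^2 = 0
    and the injectivity of phi serve to remove the unwanted linear terms. *)
Lemma automorphism_cx_sqr (phi : {lrmorphism rigid R -> rigid R}) :
  automorphism phi -> cx (phi rx) ^+ 2 = 1.
Proof.
move=> /bij_inj phi_inj.
have nil u : c1 u = 0 -> c1 (phi u) = 0.
  move=> u0; apply/eqP; rewrite -nilradical_rigid; apply/nilradicalP.
  have /nilradicalP[n un] : u \in nilradical (rigid R).
    by rewrite nilradical_rigid u0.
  by exists n; rewrite -rmorphXn un rmorph0.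
have := nil rx erefl; have := nil ry erefl; have := nil rm erefl.
have nz u : u != 0 -> phi u != 0.
  by move=> u0; rewrite -(rmorph0 phi) (inj_eq phi_inj).
have xy : phi rx * phi ry = 0.
  by rewrite -rmorphM -[RHS](rmorph0 phi); congr (phi _); by_coef.
have mm : phi rm * phi rm = 0.
  by rewrite -rmorphM -[RHS](rmorph0 phi); congr (phi _); by_coef.
have x3y5 : phi rx * (phi rx * phi rx) =
    phi ry * (phi ry * (phi ry * (phi ry * phi ry))).
  by rewrite -!rmorphM; congr (phi _); by_coef.
have x2m : phi rx * phi rx * phi rm = phi ry * phi ry * phi rm.
  by rewrite -!rmorphM; congr (phi _); by_coef.
have x3n0 : phi rx * (phi rx * phi rx) != 0.
  rewrite -!rmorphM nz//; apply/eqP => /(congr1 (@cs R)) /=.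
  by rewrite !(mulr0, mul0r, add0r, addr0, mulr1) => /eqP; rewrite oner_eq0.
have x2mn0 : phi rx * phi rx * phi rm != 0.
  rewrite -!rmorphM nz//; apply/eqP => /(congr1 (@ct R)) /=.
  by rewrite !(mulr0, mul0r, add0r, addr0, mulr1) => /eqP; rewrite oner_eq0.
move: (phi rx) (phi ry) (phi rm) xy mm x3y5 x2m x3n0 x2mn0 => P Q N.
move=> xy mm x3y5 x2m x3n0 x2mn0 N0 Q0 P0.
(* The fifth power of a nilpotent element has no y^3 term. *)
have Py : cy P = 0.
  have : cy P ^+ 3 = 0; last by move=> /eqP; rewrite expf_eq0 => /eqP.
  transitivity (cy3 (P * (P * P))); first by rewrite /= P0; ring.
  by rewrite x3y5 /= Q0; ring.
have Q5E : Q * (Q * (Q * (Q * Q))) =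
    cy Q ^+ 5 *: Rigid 0 0 0 0 0 0 0 1 0 0 0 0.
  by apply: rigid_ext; rewrite /= ?Q0; ring.
have PQ35 : cx P ^+ 3 = cy Q ^+ 5.
  transitivity (cs (P * (P * P))); first by rewrite /= P0 Py; ring.
  by rewrite x3y5 Q5E /= mulr1.
have Px : cx P != 0.
  apply: contra_neq x3n0 => Px.
  by rewrite x3y5 Q5E -PQ35 Px expr0n scale0r.
have Qx : cx Q = 0.
  apply: (mulfI Px); rewrite mulr0.
  transitivity (cx2 (P * Q)); first by rewrite /= P0 Q0; ring.
  by rewrite xy.
have Nx : cx N = 0.
  apply/eqP; rewrite -sqrf_eq0; apply/eqP.
  transitivity (cx2 (N * N)); first by rewrite /= N0; ring.
  by rewrite mm.
have Ny : cy N = 0.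
  apply/eqP; rewrite -sqrf_eq0; apply/eqP.
  transitivity (cy2 (N * N)); first by rewrite /= N0; ring.
  by rewrite mm.
have P2N : P * P * N = (cx P ^+ 2 * cm N) *: Rigid 0 0 0 0 0 0 0 0 0 0 0 1.
  by apply: rigid_ext; rewrite /= ?P0 ?Py ?N0 ?Nx ?Ny; ring.
have Q2N : ct (Q * Q * N) = cy Q ^+ 2 * cm N.
  by rewrite /= Q0 Qx N0 Nx Ny; ring.
have Nm : cm N != 0.
  by apply: contra_neq x2mn0 => Nm; rewrite P2N Nm mulr0 scale0r.
have PQ2 : cx P ^+ 2 = cy Q ^+ 2.
  by apply: (mulIf Nm); rewrite -Q2N -x2m P2N /= mulr1.
(* 4 = 10 - 6: cancel a^6 in a^10 = d^10 = a^6. *)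
have P4 : cx P ^+ 4 = 1.
  apply: (mulfI (expf_neq0 6 Px)); rewrite -exprD mulr1.
  by rewrite [RHS](exprM _ 3 2) PQ35 (exprM _ 2 5) PQ2 -!exprM.
apply/eqP; rewrite -(eqrXn2 (n := 2)) ?sqr_ge0//.
by rewrite -exprM P4 expr1n.
Qed.

(** The x-coordinate of phi x has square 1 for every automorphism phi, so it
    cannot tend to that of kappa x = 0. *)
Lemma rigid_not_dwindlable : ~ dwindlable (rigid R).
Proof.
move=> [phi [phiA phi_kappa]].
pose l : rigid R -> R^o := @cx R.
have llin : linear l by [].
have cvg0 : l (phi n rx) @[n --> \oo] --> l (kappa rx).
  exact: endo_cvg_functional (fun n => linearP (phi n))
    (kappa_linear (weil_rigid R)) llin phi_kappa.
have := cvgM cvg0 cvg0.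
rewrite (@kappaE _ _ _ 0) ?scale0r ?nilradical_rigid ?subr0//.
have -> : (fun n => l (phi n rx)) \* (fun n => l (phi n rx)) = cst 1.
  by apply/funext => n /=; rewrite -[RHS](automorphism_cx_sqr (phiA n)) expr2.
move=> /(_ eventually_filter) ll.
have one0 : (1 : R) = 0 * 0.
  exact: (cvg_unique (@norm_hausdorff _ _) (cvg_cst _) ll).
by move/eqP: one0; rewrite mulr0 oner_eq0.
Qed.

End RigidAutomorphisms.

Theorem proposition5 (R : realType) :
  (forall A : comAlgType R,
     weil_algebra A -> dwindlable A -> fixed_points A = constants A) /\
  (exists A : comAlgType R,
     [/\ weil_algebra A, ~ dwindlable A & fixed_points A = constants A]).
Proof.
split=> [A|]; first exact: dwindlable_fixed_points.
exists (rigid R : comAlgType R); split.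
- exact: weil_rigid.
- exact: rigid_not_dwindlable.
- exact: rigid_fixed_points.
Qed.
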